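(* Let $f\colon X\to Y$ be a perfect map between metrizable spaces with $Y$ being a $C$-space. For any integers $d,r\ge 0$ let $\mathcal{P}(d,r)$ denote the family of all $d$-planes $\Pi^d\subset l_2$ parallel to some coordinate plane $\Pi^r\subset l_2$. Then $C^*(X,l_2)$ (with the source limitation topology) contains a dense $G_\delta$-subset of maps $g$ such that, for all such $d,r$, every $y\in Y$ and every $\Pi^d\in\mathcal{P}(d,r)$, the set $f^{-1}(y)\cap g^{-1}(\Pi^d)$ has at most $d+1-r$ points if $r\le d$ and at most one point if $r\ge d$.
   Context: All maps are continuous. A perfect map is a closed continuous map with compact fibers. A space $Y$ is a $C$-space if for every sequence $\{\omega_i\}_{i\ge1}$ of open covers of $Y$ there is a sequence $\{\gamma_i\}_{i\ge1}$ of families of pairwise disjoint open sets such that each $\gamma_i$ refines $\omega_i$ and $\bigcup_i\gamma_i$ covers $Y$. $l_2$ is the real separable Hilbert space of square-summable sequences. A $d$-plane in $l_2$ is a $d$-dimensional affine subspace; a coordinate $r$-plane $\Pi^r$ is the linear span of $r$ of the standard basis vectors. A $d$-plane with direction space $V$ (the linear subspace of which it is a translate) is parallel to $\Pi^r$ if $\Pi^r\subset V$ when $r\le d$, and $V\subset\Pi^r$ when $r\ge d$. $C^*(X,l_2)$ is the set of all bounded continuous maps $X\to l_2$. Source limitation topology: a set $U\subset C^*(X,l_2)$ is open iff for every $g\in U$ there is a continuous function $\alpha\colon X\to(0,\infty)$ such that $\{h\in C^*(X,l_2):\|g(x)-h(x)\|\le\alpha(x)\text{ for each }x\in X\}\subset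 U$. *)

(* Defs.v *)
From HB Require Import structures.
From mathcomp Require Import all_boot all_order all_algebra.
From mathcomp Require Import finmap.
From mathcomp Require Import all_classical all_reals all_analysis.

Set Implicit Arguments.
Unset Strict Implicit.
Unset Printing Implicit Defensive.

Import Order.TTheory GRing.Theory Num.Theory.
Import numFieldNormedType.Exports.

Local Open Scope classical_set_scope.
Local Open Scope ring_scope.

Definition metrizable (R : realType) (T : topologicalType) :=
  exists dist : T -> T -> R,
    [/\ forall x y, dist x y = 0 <-> x = y,
        forall x y, dist x y = dist y x,
        forall x y z, dist x z <= dist x y + dist y z
      & forall x (A : set T), nbhs x A <->
          exists2 e : R, 0 < e & [set y | dist x y < e] `<=` A].

Definition open_cover (T : topologicalType) (w : set (set T)) :=
  (forall U, w U -> open U) /\ \bigcup_(U in w) U = setT.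

Definition refines (T : Type) (c w : set (set T)) :=
  forall U, c U -> exists2 V, w V & U `<=` V.

Definition C_space (T : topologicalType) :=
  forall w : nat -> set (set T), (forall i, open_cover (w i)) ->
  exists c : nat -> set (set T),
    [/\ forall i U, c i U -> open U,
        forall i, trivIset (c i) id,
        forall i, refines (c i) (w i)
      & \bigcup_i \bigcup_(U in c i) U = setT].

Definition perfect_map (X Y : topologicalType) (f : X -> Y) :=
  [/\ continuous f,
      forall A : set X, closed A -> closed (f @` A)
    & forall y : Y, compact (f @^-1` [set y])].

(* Since the counting measure on nat has no nonempty null set, the functions
   of LfunType are the points of l_2: no quotient is needed. *)
Definition l2 (R : realType) : Type :=
  LfunType (@counting nat R : {measure set nat -> \bar R}) (lee1n 2).

HB.instance Definition _ (R : realType) := GRing.Lmodule.copy (l2 R)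
  (LfunType (@counting nat R : {measure set nat -> \bar R}) (lee1n 2)).

Section l2_normed.
Context {R : realType}.
Implicit Types u v : l2 R.

Let mu : {measure set nat -> \bar R} := @counting nat R.

Definition l2_norm u : R := fine ('N[mu]_2%:E[EFin \o (u : nat -> R)])%E.

Lemma l2_normEFin u :
  (l2_norm u)%:E = ((\sum_(k <oo) (`|u k|%:E `^ 2)) `^ 2^-1)%E.
Proof. by rewrite [LHS]finite_norm_fine Lnorm_counting. Qed.

Lemma l2_normD u v : l2_norm (u + v) <= l2_norm u + l2_norm v.
Proof. exact: ler_LnormD. Qed.

Lemma l2_normZ (a : R) u : l2_norm (a *: u) = `|a| * l2_norm u.
Proof.
apply: EFin_inj; rewrite EFinM [LHS]finite_norm_fine finite_norm_fine.
exact: LnormZ.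
Qed.

Lemma l2_norm_eq0 u : l2_norm u = 0 -> u = 0.
Proof.
move=> /fine_Lnormr_eq0 [A [_ A0 sA]].
apply/LfuneqP => k; apply: contrapT => uk0.
have Ak : A k by apply: sA => /= /(_ I).
move: A0; rewrite /mu/= /counting; case: asboolP => // fA.
move=> /eqP; rewrite eqe pnatr_eq0 cardfs_eq0 => /eqP fA0.
have : k \in fset_set A by rewrite in_fset_set// inE.
by rewrite fA0.
Qed.

HB.instance Definition _ :=
  @Lmodule_isNormed.Build R (l2 R) l2_norm l2_normD l2_normZ l2_norm_eq0.

Definition l2_basis_fun (k i : nat) : R := (i == k)%:R.

Lemma l2_basis_Lfun k : l2_basis_fun k \in Lfun mu 2%:E.
Proof.
apply/andP; split; first by rewrite inE.
rewrite inE /= /finite_norm Lnorm_counting// (nneseries_split 0 k.+1)//;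
  last by move=> i _; exact: poweR_ge0.
rewrite [X in (_ + X)%E]eseries0 ?adde0; last first.
  move=> i /= ki _; rewrite /l2_basis_fun (gtn_eqF (ki : (k < i)%N)).
  rewrite mulr0n normr0 -[LHS]/(poweR 0%:E 2) poweR0r// pnatr_eq0.
apply/poweR_lty/lte_sum_pinfty => i _; exact/poweR_lty/ltry.
Qed.

Definition l2_basis (k : nat) : l2 R := Lfun_Sub (lee1n 2) (l2_basis_Lfun k).

End l2_normed.

Section planes.
Context {R : realType}.

Definition lin_indep (V : lmodType R) n (v : 'I_n -> V) :=
  forall c : 'I_n -> R, \sum_i c i *: v i = 0 -> forall i, c i = 0.

Definition lin_span (V : lmodType R) n (v : 'I_n -> V) : set V :=
  [set \sum_i c i *: v i | c in [set: 'I_n -> R]].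

Definition plane_with_direction d (P V : set (l2 R)) :=
  exists (p : l2 R) (v : 'I_d -> l2 R),
    [/\ lin_indep v, V = lin_span v & P = [set p + w | w in V]].

Definition coordinate_plane r (W : set (l2 R)) :=
  exists2 k : 'I_r -> nat, injective k & W = lin_span (l2_basis \o k).

Definition parallel_planes d r : set (set (l2 R)) :=
  [set P | exists V W : set (l2 R),
    [/\ plane_with_direction d P V, coordinate_plane r W,
        (r <= d)%N -> W `<=` V & (d <= r)%N -> V `<=` W]].

End planes.

Record bounded_continuous_map (R : realType) (X : topologicalType) := {
  bcm_fun :> X -> l2 R;
  bcm_continuous : continuous bcm_fun;
  bcm_bounded : bounded_fun bcm_fun }.

Section source_limitation.
Context (R : realType) (X : topologicalType).
Local Notation C := (bounded_continuous_map R X).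

HB.instance Definition _ := gen_eqMixin C.
HB.instance Definition _ := gen_choiceMixin C.

Definition source_limitation_open : set_system C :=
  [set U | forall g : C, U g -> exists alpha : X -> R,
    [/\ continuous alpha, forall x, 0 < alpha x
      & [set h : C | forall x, `|g x - h x| <= alpha x] `<=` U]].

Lemma source_limitation_openT : source_limitation_open setT.
Proof. by move=> g _; exists (fun=> 1); split=> // x; exact: cst_continuous. Qed.

Lemma source_limitation_openI : setI_closed source_limitation_open.
Proof.
move=> U V oU oV g [/oU[a [ca a0 aU]] /oV[b [cb b0 bV]]].
exists (a \min b); split=> [x|x|h /= gh].
- by apply: continuous_min; [exact: ca|exact: cb].
- by rewrite /= lt_min a0 b0.
- split; [apply: aU|apply: bV] => x /=; apply: le_trans (gh x) _.
  + by rewrite /= ge_min lexx.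
  + by rewrite /= ge_min lexx orbT.
Qed.

Lemma source_limitation_open_bigU (I : Type) (U : I -> set C) :
  (forall i, source_limitation_open (U i)) ->
  source_limitation_open (\bigcup_i U i).
Proof.
move=> oU g [i _ /oU[a [ca a0 aU]]].
by exists a; split=> // h /aU Uh; exists i.
Qed.

HB.instance Definition _ := isOpenTopological.Build C
  source_limitation_openT source_limitation_openI source_limitation_open_bigU.

Lemma openE_source_limitation (U : set C) :
  open U = source_limitation_open U.
Proof. by []. Qed.

End source_limitation.

(* Main.v *)
Require Import Defs.
From mathcomp Require Import all_boot all_order all_algebra.
From mathcomp Require Import all_classical all_reals all_analysis.
From mathcomp Require Import borel_hierarchy.
From mathcomp Require Import ring lra.
Set Implicit Arguments.
Unset Strict Implicit.
Unset Printing Implicit Defensive.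

Import Order.TTheory GRing.Theory Num.Theory.
Import numFieldNormedType.Exports.
Local Open Scope classical_set_scope.
Local Open Scope ring_scope.
Local Open Scope card_scope.

(** Two reductions make the theorem true.

    First, incidence with planes is a question about independence.  If [d + 2 - r]
    points lie in a [d]-plane whose direction contains a coordinate [r]-plane,
    then some nontrivial combination of them lies in that coordinate plane
    ([points_of_parallel_plane]), so that all but finitely many of its coordinates
    vanish; the same holds for the difference of two points when the direction is
    contained in a coordinate plane ([difference_in_parallel_plane]).  Hence it
    is enough that, for distinct points [x_i] of one fiber, a nontrivial
    combination of the vectors [g x_i] always has infinitely many nonzero
    coordinates.

    Second, this independence follows from a condition that is visibly open.  Call
    [g] isolating at scale [n] if every [x] has a coordinate [k >= n] at which
    [g x] dominates, by a factor [n + 1] and by a margin depending continuously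
    on [f x], the value of [g] at every point of the same fiber at distance at least
    [1 / (n + 1)] from [x].  Perturbing [g] by less than a fraction of the margin
    preserves the condition ([open_isolating]), and if [g] is isolating at all
    scales, a combination of its values at distinct points of a fiber is dominated,
    in arbitrarily late coordinates, by the term with the largest coefficient
    ([isolating_independent]).  So the maps that are isolating at all scales form
    the required G-delta set.

    Density is proved by writing down one approximation that is isolating at all
    scales simultaneously ([isolating_approximation]).  Because [f] is perfect,
    the norms of the tails of [g0] are locally uniformly small over [Y], so the
    coordinates of [g0 x] can be faded out beyond an index depending continuously
    on [f x].  In the freed coordinates one inserts a sequence of functions
    [phi k] whose supports meet each fiber in small sets, every scale being
    served arbitrarily late ([fiberwise_bump_sequence]).  At a late coordinate with
    [phi k x] bounded away from zero the far points of the fiber get the value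
    zero, which is the isolating condition.

    Only countably many coordinates are available, while [Y] may need uncountably
    many local pieces.  This is where the [C]-property enters: applied to a
    constant sequence of covers it refines a cover of [Y] by countably many
    disjoint families, and the bumps living over the members of one disjoint
    family can be put together into a single function ([fiberwise_bumps]). *)

(** * Continuous moduli and uniformity over fibers *)

Section Moduli.
Context {R : realType}.

Definition compatible_metric (T : topologicalType) (dist : T -> T -> R) :=
  [/\ forall x y, dist x y = 0 <-> x = y,
      forall x y, dist x y = dist y x,
      forall x y z, dist x z <= dist x y + dist y z
    & forall x (A : set T), nbhs x A <->
        exists2 e : R, 0 < e & [set y | dist x y < e] `<=` A].

Lemma compatible_metric_ge0 (T : topologicalType) (dist : T -> T -> R) x y :
  compatible_metric dist -> 0 <= dist x y.
Proof.
move=> [d0 dC dD _]; have := dD x y x.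
by rewrite (dC y x) (proj2 (d0 x x) erefl) -mulr2n pmulrn_lge0.
Qed.

Lemma near_ball (T : topologicalType) (dist : T -> T -> R) (x : T) (e : R) :
  compatible_metric dist -> 0 < e -> \forall y \near x, dist x y < e.
Proof. by move=> [_ _ _ dN] e0; apply/dN; exists e. Qed.

Lemma lipschitz_continuous (T : topologicalType) (dist : T -> T -> R)
    (F : T -> R) :
  compatible_metric dist -> (forall x y, F x <= F y + dist x y) ->
  continuous F.
Proof.
move=> cd FL x; apply/cvgrPdist_lt => e e0.
have [_ dC _ _] := cd.
apply: filterS (near_ball x cd e0) => y xy.
rewrite ltr_norml; have := FL x y; have := FL y x; rewrite dC.
lra.
Qed.

(** One construction replaces the partitions of unity that would otherwise be
    used.  The supremum of the radii [e] for which [P t' e] holds on the whole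
    ball of radius [e] around [t] is a 1-Lipschitz function of [t], and half of
    it is a radius at which [P] does hold.  With [P] independent of the radius
    this gives functions that are positive exactly on an open set. *)
Lemma continuous_pointwise_modulus (T : topologicalType) (dist : T -> T -> R)
    (P : T -> R -> Prop) :
  compatible_metric dist ->
  (forall t a b, a <= b -> P t b -> P t a) ->
  exists beta : T -> R,
    [/\ continuous beta, forall t, 0 <= beta t <= 1,
        forall t, 0 < beta t -> P t (beta t)
      & forall t, (exists2 e, 0 < e & \forall t' \near t, P t' e) ->
          0 < beta t].
Proof.
move=> cd Pdown.
have d_ge0 x y := compatible_metric_ge0 x y cd.
have [d0 dC dD dN] := cd.
pose S t := [set e : R | 0 <= e <= 1 /\
  forall t', dist t t' < e -> P t' e].
have S0 t : S t 0.
  by split=> [|t']; [rewrite lexx ler01|rewrite ltNge d_ge0].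
have hS t : has_sup (S t).
  by split; [exists 0|exists 1 => e [/andP[]]].
have sup_ge0 t : 0 <= sup (S t) by apply: ub_le_sup => //; have [] := hS t.
have sup_le1 t : sup (S t) <= 1.
  by apply: ge_sup; [exists 0|move=> e [/andP[]]].
exists (fun t => sup (S t) / 2); split.
- apply: (lipschitz_continuous cd) => x y.
  suff : sup (S x) - dist x y <= sup (S y).
    by have := d_ge0 x y; lra.
  rewrite lerBlDr; apply: ge_sup; first by exists 0.
  move=> e [/andP[e0 e1] eP]; rewrite -lerBlDr.
  have [le0|gt0] := leP (e - dist x y) 0; first exact: le_trans (sup_ge0 y).
  apply: ub_le_sup; first by have [] := hS y.
  split=> [|z yz].
    by have := d_ge0 x y; lra.
  apply: Pdown (eP z _); first by have := d_ge0 x y; lra.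
  by have := dD x y z; lra.
- by move=> t; have := sup_ge0 t; have := sup_le1 t; lra.
- move=> t b0.
  have [e [_ eP] be] : exists2 e, S t e & sup (S t) / 2 < e.
    have [e Se be] := sup_adherent b0 (hS t); exists e => //; lra.
  apply: Pdown (ltW be) (eP t _).
  by rewrite (proj2 (d0 t t) erefl); lra.
- move=> t [e e0 /dN[r r0 rP]].
  suff : Num.min 1 (Num.min e r) <= sup (S t).
    have : 0 < Num.min 1 (Num.min e r) by rewrite !lt_min ltr01 e0 r0.
    by lra.
  apply: ub_le_sup; first by have [] := hS t.
  split=> [|t' tt'].
    by rewrite ge_min lexx !le_min ler01 (ltW e0) (ltW r0).
  move: tt'; rewrite !lt_min => /and3P[_ _ tr].
  by apply: Pdown (rP t' tr); rewrite !ge_min lexx !orbT.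
Qed.

(** Compactness of the fiber glues finitely many neighbourhoods into one open
    set around it, and since [f] is closed that set contains the preimage of a
    neighbourhood of [y]. *)
Lemma fiber_local (X Y : topologicalType) (f : X -> Y)
    (T : set X -> Prop) :
  perfect_map f -> T set0 ->
  (forall A B, A `<=` B -> T B -> T A) ->
  (forall A B, T A -> T B -> T (A `|` B)) ->
  (forall x : X, exists2 A : set X, nbhs x A & T A) ->
  forall y : Y, exists2 V : set Y, open_nbhs y V & T (f @^-1` V).
Proof.
move=> [cf fclosed fcompact] T0 Tsub TU Tloc y.
(* Sets ordered by inclusion among those with property T: near covering
   compactness along this filter plays the role of finite subcovers. *)
pose F : set_system (set X) :=
  [set E | exists2 A, T A & forall B, T B -> A `<=` B -> E B].
have FF : Filter F.
  split.
  - by exists set0.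
  - move=> E1 E2 [A1 TA1 E1P] [A2 TA2 E2P]; exists (A1 `|` A2); first exact: TU.
    by move=> B TB; rewrite subUset => -[A1B A2B]; split; [exact: E1P|exact: E2P].
  - by move=> E1 E2 E12 [A TA EA]; exists A => // B TB AB; apply/E12/EA.
have /compact_near_coveringP/(_ _ F (fun B x => B^° x) FF) := fcompact y.
case.
  move=> x _; have [A /nbhs_interior Ax TA] := Tloc x.
  exists (A^°, [set B | A `<=` B]) => /=; first by split => //; exists A.
  by move=> [z B] /= [Az AB]; exact: filterS AB Az.
move=> A TA /(_ A TA (fun _ h => h)) fA.
exists (~` (f @` ~` A^°)).
  split; last by move=> [x nAx fxy]; apply: nAx; apply: fA.
  by apply: closed_openC; apply: fclosed; apply: open_closedC; exact: open_interior.
apply: Tsub TA => x nx; apply: interior_subset.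
by apply: contrapT => nAx; apply: nx; exists x.
Qed.

End Moduli.

(** * Norm, tails and continuity in the Hilbert space *)

Section Hilbert.
Context {R : realType}.
Implicit Types u v : l2 R.

Lemma l2_norm_leP u (M : R) : 0 <= M ->
  (forall n, \sum_(k < n) u k ^+ 2 <= M ^+ 2) <-> `|u| <= M.
Proof.
move=> M0.
have t0 (k : nat) : (0 <= `|u k|%:E `^ 2)%E by exact: poweR_ge0.
have partial n : (\sum_(0 <= k < n) `|u k|%:E `^ 2)%E =
    (\sum_(k < n) u k ^+ 2)%:E :> \bar R.
  rewrite big_mkord -sumEFin; apply: eq_bigr => k _.
  by rewrite poweR_EFin (powR_mulrn 2%N)// real_normK// num_real.
have -> : (`|u| <= M) = (\sum_(k <oo) `|u k|%:E `^ 2 <= (M ^+ 2)%:E)%E.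
  rewrite -lee_fin [X in (X <= _)%E]l2_normEFin.
  have s0 : (0 <= \sum_(k <oo) `|u k|%:E `^ 2)%E by exact: nneseries_ge0.
  have -> : M%:E = (((M ^+ 2)%:E) `^ 2^-1)%E :> \bar R.
    by rewrite poweR_EFin -(powR_mulrn 2%N M0) -powRrM mulfV ?powRr1// pnatr_eq0.
  by rewrite !poweR12_sqrt ?lee_sqrt// lee_fin sqr_ge0.
split => [h|h n].
- apply: lime_le; first exact: is_cvg_nneseries.
  by apply: nearW => n; rewrite partial lee_fin.
- by rewrite -lee_fin -partial; apply: le_trans h; exact: nneseries_lim_ge.
Qed.

Lemma l2_of_square_summable (w : nat -> R) (M : R) :
  (forall n, \sum_(k < n) w k ^+ 2 <= M) -> {u : l2 R | forall k, u k = w k}.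
Proof.
move=> wM.
have wL : w \in Lfun (@counting nat R) 2%:E.
  apply/andP; split; first by rewrite inE.
  rewrite inE /= /finite_norm Lnorm_counting//; apply: poweR_lty.
  apply: (@le_lt_trans _ _ M%:E); last exact: ltry.
  apply: lime_le; first by apply: is_cvg_nneseries => k _ _; exact: poweR_ge0.
  apply: nearW => n; rewrite big_mkord.
  rewrite (eq_bigr (fun k : 'I_n => (w k ^+ 2)%:E)) => [|k _].
    by rewrite sumEFin lee_fin; exact: wM.
  by rewrite /= (powR_mulrn 2%N)// real_normK// num_real.
by exists (Lfun_Sub (lee1n 2) wL).
Qed.


Lemma l2_partial_sum_le u n : \sum_(k < n) u k ^+ 2 <= `|u| ^+ 2.
Proof. by move: n; apply/l2_norm_leP. Qed.

Lemma l2_segment_le u N n : \sum_(N <= k < n) u k ^+ 2 <= `|u| ^+ 2.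
Proof.
apply: le_trans (l2_partial_sum_le u n); rewrite -(big_mkord xpredT (fun k => u k ^+ 2)).
have [Nn|nN] := leqP N n; last first.
  by rewrite (big_geq (ltnW nN)); apply: sumr_ge0 => k _; exact: sqr_ge0.
rewrite [leRHS](big_cat_nat (n := N))//= lerDr; apply: sumr_ge0 => k _.
exact: sqr_ge0.
Qed.

Lemma l2_coord_le u k : `|u k| <= `|u|.
Proof.
rewrite -ler_sqr ?nnegrE// real_normK ?num_real//.
by have := l2_segment_le u k k.+1; rewrite big_nat1.
Qed.

Lemma l2_tail u (e : R) : 0 < e ->
  exists N, forall n, \sum_(N <= k < n) u k ^+ 2 <= e ^+ 2.
Proof.
move=> e0; have [ue|eu] := leP `|u| e.
  exists 0%N => n; apply: le_trans (l2_segment_le u 0 n) _.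
  by rewrite ler_sqr ?nnegrE// ltW.
pose M := Num.sqrt (`|u| ^+ 2 - e ^+ 2).
have ue0 : 0 <= `|u| ^+ 2 - e ^+ 2 by rewrite subr_ge0 ler_sqr ?nnegrE// ltW.
have MM : M ^+ 2 = `|u| ^+ 2 - e ^+ 2 by rewrite sqr_sqrtr.
have : ~ (`|u| <= M).
  apply/negP; rewrite -ltNge -ltr_sqr ?nnegrE ?sqrtr_ge0// MM.
  by rewrite ltrBlDr ltrDl exprn_gt0.
move=> /(contra_not (proj1 (l2_norm_leP u (sqrtr_ge0 _)))).
move=> /existsNP[N /negP]; rewrite -ltNge MM => NM; exists N => n.
have [Nn|nN] := leqP N n; last first.
  by rewrite (big_geq (ltnW nN)) sqr_ge0.
have := l2_partial_sum_le u n.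
rewrite -(big_mkord xpredT (fun k => u k ^+ 2)) (big_cat_nat (n := N))//=.
rewrite big_mkord; lra.
Qed.

Lemma sum_sqrD_le2 (I : Type) (r : seq I) (P : pred I) (a b : I -> R) (A B : R) :
  \sum_(i <- r | P i) a i ^+ 2 <= A -> \sum_(i <- r | P i) b i ^+ 2 <= B ->
  \sum_(i <- r | P i) (a i + b i) ^+ 2 <= 2 * (A + B).
Proof.
move=> aA bB; apply: le_trans (_ : 2 * (\sum_(i <- r | P i) a i ^+ 2 +
  \sum_(i <- r | P i) b i ^+ 2) <= _); last by rewrite ler_pM2l// lerD.
rewrite -big_split mulr_sumr; apply: ler_sum => i _ /=.
have := sqr_ge0 (a i - b i); lra.
Qed.

Lemma l2_tail_near (X : topologicalType) (u : X -> l2 R) (x : X) (e : R) :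
  {for x, continuous u} -> 0 < e -> exists N, \forall x' \near x,
    forall n, \sum_(N <= k < n) u x' k ^+ 2 <= e ^+ 2.
Proof.
move=> cu e0; have e2 : 0 < e / 2 by rewrite divr_gt0.
have [N NP] := l2_tail (u x) e2; exists N.
have /cvgrPdist_le/(_ _ e2) := cu; apply: filterS => x' xx' n.
rewrite (eq_bigr (fun k => (u x k + (u x' - u x) k) ^+ 2)); last first.
  by move=> k _; congr (_ ^+ 2); rewrite -[LHS](subrK (u x k)) addrC.
apply: le_trans (sum_sqrD_le2 (NP n) (l2_segment_le _ N n)) _.
rewrite distrC.
have : `|u x - u x'| ^+ 2 <= (e / 2) ^+ 2 by rewrite ler_sqr ?nnegrE// ltW.
lra.
Qed.

(** With uniformly small tails near each point, only finitely many coordinates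
    matter. *)
Lemma continuous_l2 (X : topologicalType) (u : X -> l2 R) :
  (forall k, continuous (fun x => u x k : R)) ->
  (forall (x : X) (e : R), 0 < e -> exists N, \forall x' \near x,
    forall n, \sum_(N <= k < n) u x' k ^+ 2 <= e ^+ 2) ->
  continuous u.
Proof.
move=> cu tu x; apply/cvgrPdist_le => e e0.
have e3 : 0 < e / 3 by rewrite divr_gt0.
have [N NP] := tu x _ e3.
have Nx : \forall x' \near x, \sum_(k < N) (u x k - u x' k) ^+ 2 <= (e / 3) ^+ 2.
  have : (fun x' => \sum_(k < N) (u x k - u x' k) ^+ 2) @ x -->
      \sum_(k < N) (u x k - u x k) ^+ 2.
    apply: cvg_big => [|k _]; first exact: add_continuous.
    apply: cvgM; apply: cvgB; first [exact: cvg_cst|exact: cu].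
  rewrite big1 => [|k _]; last by rewrite subrr expr0n.
  move=> /cvgrPdist_le/(_ _ (exprn_gt0 2 e3)); apply: filterS => x'.
  by rewrite sub0r normrN; apply: le_trans; exact: ler_norm.
have tx := nbhs_singleton NP.
apply: filterS2 NP Nx => x' tx' hx'.
apply/l2_norm_leP; first exact: ltW.
move=> n; have [nN|Nn] := leqP n N.
  apply: le_trans (_ : (e / 3) ^+ 2 <= _); last first.
    by rewrite ler_sqr ?nnegrE ?ler_pdivrMr ?ltW//; lra.
  apply: le_trans hx'.
  rewrite -!(big_mkord xpredT (fun k => (u x k - u x' k) ^+ 2)).
  rewrite [leRHS](big_cat_nat (n := n))//= lerDl; apply: sumr_ge0 => k _.
  exact: sqr_ge0.
rewrite -(big_mkord xpredT (fun k => (u x k - u x' k) ^+ 2)).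
rewrite (big_cat_nat (n := N))//= ?(ltnW Nn)// big_mkord.
have txN : \sum_(N <= k < n) (- u x' k) ^+ 2 <= (e / 3) ^+ 2.
  by under eq_bigr do rewrite sqrrN.
apply: le_trans (lerD hx' (sum_sqrD_le2 (tx n) txN)) _.
have := sqr_ge0 e; lra.
Qed.

End Hilbert.

(** * Bump functions that are small on every fiber *)

Section Bumps.
Context {R : realType}.

(** The strict bound on the diameter of the supports is what later separates the
    points of a fiber that are at distance at least [e]. *)
Definition bump_family (X : topologicalType) (dist : X -> X -> R) (e : R)
    (q : nat -> X -> R) :=
  [/\ forall i, continuous (q i),
      forall i x, 0 <= q i x <= 1
    & forall i x x', q i x != 0 -> q i x' != 0 -> dist x x' < e].

Definition uniformly_positive_on (X : Type) (A : set X) (q : nat -> X -> R) :=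
  exists (n : nat) (delta : R), 0 < delta /\
    forall x, A x -> exists2 i, (i < n)%N & delta <= q i x.

Lemma zero_bump_family (X : topologicalType) (dist : X -> X -> R) (e : R) :
  bump_family dist e (fun _ _ => 0).
Proof.
split=> [i|i x|i x x']; first exact: cst_continuous.
- by rewrite lexx ler01.
- by rewrite eqxx.
Qed.

Lemma bump_at_point (X : topologicalType) (dist : X -> X -> R) (e : R) (p : X) :
  compatible_metric dist -> 0 < e -> exists2 A, nbhs p A &
    exists2 q, bump_family dist e q & uniformly_positive_on A q.
Proof.
move=> cd e0; have d_ge0 x y := compatible_metric_ge0 x y cd.
have [d0 dC dD _] := cd.
pose r := Num.min 1 (e / 2).
have r0 : 0 < r by rewrite lt_min ltr01 divr_gt0.
have re : r <= e / 2 by rewrite ge_min lexx orbT.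
exists [set x | dist x p < r / 2].
  have := near_ball p cd (divr_gt0 r0 (ltr0n R 2)); apply: filterS => x.
  by rewrite /= dC.
exists (fun _ x => Num.max 0 (r - dist x p)); last first.
  exists 1%N, (r / 2); split=> [|x /= xp]; first by rewrite divr_gt0.
  by exists 0%N => //; rewrite le_max; apply/orP; right; lra.
split.
- move=> _; apply: (lipschitz_continuous cd) => x y.
  rewrite ge_max; apply/andP; split.
    by rewrite addr_ge0// le_max lexx.
  rewrite (le_trans (y := r - dist y p + dist x y))//.
    by have := dD y x p; rewrite (dC y x); lra.
  by rewrite lerD2r le_max lexx orbT.
- move=> _ x; rewrite le_max lexx ge_max ler01/=.
  have := d_ge0 x p; have : r <= 1 by rewrite ge_min lexx.
  by lra.
- have pos x : Num.max 0 (r - dist x p) != 0 -> dist x p < r.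
    apply: contraNT; rewrite -leNgt => h; apply/eqP/max_idPl; lra.
  move=> _ x x' /pos xr /pos x'r.
  by have := dD x p x'; rewrite (dC p); lra.
Qed.

(** Finite families of bumps are stable under concatenation, so the gluing
    principle over fibers applies to them. *)
Lemma bump_family_over_nbhs (X Y : topologicalType) (f : X -> Y)
    (dist : X -> X -> R) (e : R) (y : Y) :
  perfect_map f -> compatible_metric dist -> 0 < e ->
  exists2 V : set Y, open_nbhs y V & exists2 q, bump_family dist e q &
    uniformly_positive_on (f @^-1` V) q.
Proof.
move=> pf cd e0.
apply: (fiber_local (T := fun A => exists2 q, bump_family dist e q &
  uniformly_positive_on A q)) => //.
- exists (fun _ _ => 0); first exact: zero_bump_family.
  by exists 0%N, 1; split=> // x [].
- move=> A B AB [q bq [n [delta [delta0 qB]]]]; exists q => //.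
  by exists n, delta; split=> // x /AB; exact: qB.
- move=> A B [q [cq q01 qe] [n [a [a0 qA]]]] [q' [cq' q'01 q'e] [n' [b [b0 qB]]]].
  pose pq i := if (i < n)%N then q i else q' (i - n)%N.
  exists pq.
    by split=> [i|i x|i x x']; rewrite /pq; case: ifP => _ //; first [exact: qe|exact: q'e].
  exists (n + n')%N, (Num.min a b); split; first by rewrite lt_min a0 b0.
  move=> x [/qA[i ni qi]|/qB[i ni qi]].
    by exists i; rewrite ?ltn_addr// /pq ni ge_min qi.
  by exists (n + i)%N; rewrite ?ltn_add2l// /pq ltnNge leq_addr/= addKn ge_min qi orbT.
- by move=> x; exact: bump_at_point.
Qed.

(** The [C]-property, used with the same cover at every stage, yields countably
    many disjoint families [c s] of open sets of [Y] over each of which a finite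
    family of bumps is available.  Disjointness allows the families over the
    members of [c s] to be assembled into one, and the factor [psi s], which
    vanishes exactly outside the union of [c s], makes the result continuous.
    Smallness of the supports survives only fiberwise, since a fiber lies over
    a single member of [c s]. *)
Lemma fiberwise_bumps (X Y : topologicalType) (f : X -> Y)
    (distX : X -> X -> R) (distY : Y -> Y -> R) (e : R) :
  perfect_map f -> C_space Y ->
  compatible_metric distX -> compatible_metric distY -> 0 < e ->
  exists phi : nat -> nat -> X -> R,
    [/\ forall s i, continuous (phi s i),
        forall s i x, 0 <= phi s i x <= 1,
        forall s i x x', f x = f x' -> phi s i x != 0 -> phi s i x' != 0 ->
          distX x x' < e
      & forall y : Y, exists s, exists2 V : set Y, nbhs y V &
          uniformly_positive_on (f @^-1` V) (phi s)].
Proof.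
move=> pf CY cdX cdY e0; have cf : continuous f by case: pf.
pose w := [set V : set Y | open V /\ exists2 q, bump_family distX e q &
  uniformly_positive_on (f @^-1` V) q].
have ow : open_cover w.
  split=> [V []//|]; rewrite -subTset => y _.
  have [V [oV Vy] hV] := bump_family_over_nbhs y pf cdX e0.
  by exists V.
have [c [co cdisj cw ccov]] := CY (fun=> w) (fun=> ow).
have /choice[Q QP] : forall U, exists Q, bump_family distX e Q /\
    ((exists2 V, w V & U `<=` V) -> uniformly_positive_on (f @^-1` U) Q).
  move=> U.
  have [[V [_ [q bq [n [a [a0 qV]]]]] UV]|nV] := pselect (exists2 V, w V & U `<=` V).
    exists q; split=> // _; exists n, a; split=> // x Ux; apply: qV; exact: UV.
  by exists (fun _ _ => 0); split=> //; exact: zero_bump_family.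
pose O s := \bigcup_(U in c s) U.
have /choice[psi psiP] : forall s, exists psi : Y -> R,
    [/\ continuous psi, forall y, 0 <= psi y <= 1,
        forall y, 0 < psi y -> O s y & forall y, O s y -> 0 < psi y].
  move=> s.
  have [psi [cpsi psi01 psiO Opsi]] :=
    continuous_pointwise_modulus (P := fun y _ => O s y) cdY (fun _ _ _ _ h => h).
  exists psi; split=> // y Oy; apply: Opsi; exists 1 => //.
  apply: open_nbhs_nbhs; split=> //; apply: bigcup_open => U cU; exact: co cU.
(* The member of c s that contains y, when there is one. *)
pose u s y := xget set0 [set U | c s U /\ U y].
have uP s U y : c s U -> U y -> u s y = U.
  move=> cU Uy; rewrite /u; case: xgetP => [U' _ [cU' U'y]|/(_ U)]; last by case.
  by apply: (cdisj s) => //; exists y.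
exists (fun s i x => psi s (f x) * Q (u s (f x)) i x); split.
- move=> s i x; have [cpsi psi01 psiO _] := psiP s.
  have [[U cU Ufx]|nO] := pselect (O s (f x)).
    have [[cQ _ _] _] := QP U.
    rewrite /continuous_at (uP _ _ _ cU Ufx).
    apply: cvg_trans (_ : (fun z => psi s (f z) * Q U i z) @ x --> _); last first.
      apply: cvgM; last exact: cQ.
      by apply: (@continuous_comp _ _ _ f (psi s)); [exact: cf|exact: cpsi].
    apply: near_eq_cvg.
    have : nbhs x (f @^-1` U) by apply: cf; apply: open_nbhs_nbhs; split=> //; exact: co cU.
    by apply: filterS => z Uz; rewrite (uP _ _ _ cU Uz).
  have psi0 : psi s (f x) = 0.
    apply/eqP; rewrite eq_le; have /andP[-> _] := psi01 (f x).
    by rewrite andbT leNgt; apply/negP => /psiO.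
  rewrite /continuous_at psi0 mul0r; apply/cvgrPdist_lt => r r0.
  have : psi s (f z) @[z --> x] --> psi s (f x).
    by apply: (@continuous_comp _ _ _ f (psi s)); [exact: cf|exact: cpsi].
  rewrite psi0 => /cvgrPdist_lt/(_ r r0); apply: filterS => z.
  rewrite !sub0r !normrN normrM; apply: le_lt_trans.
  have [[_ Q01 _] _] := QP (u s (f z)).
  have /andP[Q0 Q1] := Q01 i z.
  by rewrite ler_piMr// ger0_norm.
- move=> s i x; have [_ psi01 _ _] := psiP s; have /andP[p0 p1] := psi01 (f x).
  have [[_ Q01 _] _] := QP (u s (f x)); have /andP[Q0 Q1] := Q01 i x.
  by rewrite mulr_ge0//= mulr_ile1.
- move=> s i x x' fxx'; rewrite !mulf_eq0 !negb_or fxx' => /andP[_ qx] /andP[_ qx'].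
  by have [[_ _ Qe] _] := QP (u s (f x')); exact: Qe qx qx'.
- move=> y; have [s _ [U cU Uy]] : (\bigcup_i \bigcup_(U in c i) U) y by rewrite ccov.
  have [cpsi psi01 _ Opsi] := psiP s.
  have psiy : 0 < psi s y by apply: Opsi; exists U.
  have [_ /(_ (cw s U cU))[n [a [a0 QU]]]] := QP U.
  exists s, (U `&` [set y' | psi s y / 2 < psi s y']).
    apply: filterI; first by apply: open_nbhs_nbhs; split=> //; exact: co cU.
    have := cpsi y; move=> /cvgrPdist_lt/(_ _ (divr_gt0 psiy (ltr0n R 2))).
    by apply: filterS => y'; rewrite ltr_norml => /andP[_] /=; lra.
  exists n, (psi s y / 2 * a); split; first by rewrite mulr_gt0// divr_gt0.
  move=> x [Ux px]; have [i ni ai] := QU x Ux.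
  by exists i => //; rewrite (uP _ _ _ cU Ux) ler_pM// ltW// divr_gt0.
Qed.

(** All scales and all bumps are enumerated in one sequence in which every bump
    occurs infinitely often.  The bound [N] on the index makes the coefficients
    of these bumps in a series bounded below near [y]. *)
Lemma fiberwise_bump_sequence (X Y : topologicalType) (f : X -> Y)
    (distX : X -> X -> R) (distY : Y -> Y -> R) :
  perfect_map f -> C_space Y ->
  compatible_metric distX -> compatible_metric distY ->
  exists phi : nat -> X -> R,
    [/\ forall k, continuous (phi k), forall k x, 0 <= phi k x <= 1
      & forall (y : Y) (e : R) (M : nat), 0 < e -> exists N,
        exists2 delta : R, 0 < delta & \forall y' \near y, forall x, f x = y' ->
          exists k, [/\ (M <= k <= N)%N, delta <= phi k x &
            forall x', f x' = f x -> phi k x' != 0 -> distX x x' < e]].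
Proof.
move=> pf CY cdX cdY.
have e0 n : 0 < n.+1%:R^-1 :> R by rewrite invr_gt0 ltr0Sn.
have [phi phiP] := choice (fun n => fiberwise_bumps pf CY cdX cdY (e0 n)).
(* The 2-adic valuation takes every value infinitely often. *)
exists (fun k => if unpickle (logn 2 k.+1) is Some (n, s, i) then phi n s i
  else fun=> 0); split.
- move=> k; case: unpickle => [[[n s] i]|]; last exact: cst_continuous.
  by have [h _ _ _] := phiP n; exact: h.
- move=> k x; case: unpickle => [[[n s] i]|]; last by rewrite lexx ler01.
  by have [_ h _ _] := phiP n; exact: h.
- move=> y e M e_gt0.
  have [n ne] : exists n : nat, n.+1%:R^-1 < e.
    exists (Num.trunc e^-1).
    by rewrite invf_plt ?posrE ?ltr0Sn//; exact: truncnS_gt.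
  have [_ _ phismall /(_ y)[s [V yV [I [delta [delta0 phiV]]]]]] := phiP n.
  (* An index at least M at which the bump coded by (n, s, i) occurs. *)
  pose k (i : nat) := (2 ^ pickle (n, s, i) * M.*2.+1).-1.
  have kS i : (k i).+1 = (2 ^ pickle (n, s, i) * M.*2.+1)%N.
    by rewrite prednK// muln_gt0 expn_gt0.
  have kphi i : unpickle (logn 2 (k i).+1) = Some (n, s, i).
    rewrite kS lognM ?expn_gt0// pfactorK// logn_coprime ?addn0 ?pickleK//.
    by rewrite coprime2n/= odd_double.
  have Mk i : (M <= k i)%N.
    rewrite -ltnS kS; apply: (@leq_trans M.*2.+1); first by rewrite ltnS -addnn leq_addr.
    by rewrite leq_pmull// expn_gt0.
  exists (\max_(i < I) k i)%N, delta => //.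
  apply: filterS yV => y' Vy' x fxy'; rewrite -fxy' in Vy'.
  have [i iI dphi] := phiV x Vy'.
  exists (k i); rewrite kphi; split=> //.
    by rewrite Mk/= (leq_bigmax (Ordinal iI)).
  move=> x' fx' phix'; apply: lt_trans ne; apply: (phismall s i) => //.
  by rewrite gt_eqF// (lt_le_trans delta0).
Qed.

End Bumps.

(** * The isolating condition *)

Section Isolating.
Context {R : realType}.

Lemma modulus_over_fibers (X Y : topologicalType) (f : X -> Y)
    (distY : Y -> Y -> R) (P : X -> R -> Prop) :
  perfect_map f -> compatible_metric distY ->
  (forall x a b, a <= b -> P x b -> P x a) ->
  (forall x : X, exists2 e, 0 < e & \forall x' \near x, P x' e) ->
  exists eps : Y -> R, [/\ continuous eps, forall y, 0 < eps y <= 1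
    & forall x, P x (eps (f x))].
Proof.
move=> pf cdY Pdown Ploc.
have [eps [ceps eps01 epsP epspos]] := continuous_pointwise_modulus
  (P := fun y e => forall x, f x = y -> P x e) cdY
  (fun y a b ab Pb x fxy => Pdown x a b ab (Pb x fxy)).
have eps0 y : 0 < eps y.
  apply: epspos.
  have [|||x|V /open_nbhs_nbhs yV [e e0 PV]] := fiber_local
      (T := fun A => exists2 e : R, 0 < e & forall x, A x -> P x e) pf _ _ _ _ y.
  - by exists 1.
  - by move=> A B AB [e e0 PB]; exists e => // x /AB; exact: PB.
  - move=> A B [a a0 PA] [b b0 PB]; exists (Num.min a b).
      by rewrite lt_min a0 b0.
    move=> x [/PA|/PB]; apply: Pdown; by rewrite ge_min lexx ?orbT.
  - by have [e e0 Px] := Ploc x; exists [set x' | P x' e] => //; exists e.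
  exists e => //; apply: filterS yV => y' Vy' x fxy'; apply: PV.
  by rewrite /= fxy'.
exists eps; split=> // [y|x]; last exact: epsP.
by rewrite eps0; have /andP[] := eps01 y.
Qed.

Lemma sum_half_pow_le (N n : nat) :
  \sum_(N <= k < n) 2^-1 ^+ k.+1 <= 2^-1 ^+ N :> R.
Proof.
have h0 k : 0 <= 2^-1 ^+ k :> R by rewrite exprn_ge0// invr_ge0.
have [Nn|nN] := leqP N n; last by rewrite (big_geq (ltnW nN)).
rewrite (eq_big_nat _ _ (F2 := fun k => - 2^-1 ^+ k.+1 - (- 2^-1 ^+ k))).
  by rewrite telescope_sumr// opprK addrC gerBl.
by move=> k _; rewrite exprS; field.
Qed.

Lemma continuous_l2_coord (X : topologicalType) (u : X -> l2 R) k :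
  continuous u -> continuous (fun x => u x k : R).
Proof.
move=> cu x; apply/cvgrPdist_lt => e e0.
have /cvgrPdist_lt/(_ e e0) := cu x; apply: filterS => x'.
by apply: le_lt_trans; exact: (l2_coord_le (u x - u x') k).
Qed.

(** The margin [beta] is a function on [Y] so that it is shared by all the points
    of a fiber that are compared; its being continuous and positive makes the
    condition open in the source limitation topology. *)
Definition isolating (X Y : topologicalType) (f : X -> Y)
    (dist : X -> X -> R) (n : nat) (g : X -> l2 R) :=
  exists beta : Y -> R, [/\ continuous beta, forall y, 0 < beta y
    & forall x, exists k, [/\ (n <= k)%N, beta (f x) <= `|g x k|
        & forall x', f x' = f x -> n.+1%:R^-1 <= dist x x' ->
            n.+1%:R * `|g x' k| + beta (f x) <= `|g x k|]].

Lemma open_isolating (X Y : topologicalType) (f : X -> Y)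
    (dist : X -> X -> R) (n : nat) : continuous f ->
  open [set g : bounded_continuous_map R X | isolating f dist n g].
Proof.
move=> cf; rewrite openE_source_limitation => g /= [beta [cbeta beta0 gP]].
pose C : R := (2 * n.+2%:R)^-1.
have C0 : 0 < C by rewrite invr_gt0 mulr_gt0.
(* With this tolerance the two sides of the domination inequality move by at
   most (n + 2) * beta * C = beta / 2 in total, half of the margin. *)
exists (fun x => beta (f x) * C); split.
- move=> x; apply: cvgM; last exact: cvg_cst.
  by apply: (@continuous_comp _ _ _ f beta); [exact: cf|exact: cbeta].
- by move=> x; rewrite mulr_gt0.
- move=> h gh; exists (fun y => beta y / 2); split.
  + by move=> y; apply: cvgM; [exact: cbeta|exact: cvg_cst].
  + by move=> y; rewrite divr_gt0.
  + move=> x; have [k [nk gk gfar]] := gP x.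
    have CE : (1 + n.+1%:R) * (beta (f x) * C) = beta (f x) / 2.
      rewrite -[1 + _](natrD _ 1) add1n mulrCA; congr (_ * _).
      by rewrite /C invfM mulrCA mulfV ?mulr1// pnatr_eq0.
    have close z : f z = f x -> `|g z k - h z k| <= beta (f x) * C.
      by move=> <-; apply: le_trans (gh z); exact: (l2_coord_le (g z - h z) k).
    have n0 : 0 <= n.+1%:R * (beta (f x) * C) by rewrite !mulr_ge0// ltW.
    have hx : `|g x k| - beta (f x) * C <= `|h x k|.
      have := close x erefl; have := ler_normD (g x k - h x k) (h x k).
      by rewrite subrK; lra.
    exists k; split=> //; first by lra.
    move=> x' fx' far; have := gfar x' fx' far.
    have : n.+1%:R * `|h x' k| <= n.+1%:R * (`|g x' k| + beta (f x) * C).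
      rewrite ler_wpM2l//; have := close x' fx'; rewrite distrC.
      by have := ler_normD (h x' k - g x' k) (g x' k); rewrite subrK; lra.
    lra.
Qed.

(** Take the index [i] with the largest coefficient and a scale [n] that exceeds
    [m] and resolves the distances between the points.  In the coordinate that
    isolates [x i], the other at most [n] terms have absolute values less than
    the [i]-th term divided by [n + 1], so they cannot cancel it. *)
Lemma isolating_independent (X Y : topologicalType) (f : X -> Y)
    (dist : X -> X -> R) (g : X -> l2 R) (m M : nat) (y : Y) (x : 'I_m -> X)
    (c : 'I_m -> R) (i0 : 'I_m) :
  compatible_metric dist -> (forall n, isolating f dist n g) ->
  injective x -> (forall i, f (x i) = y) -> c i0 != 0 ->
  exists2 k, (M <= k)%N & \sum_i c i * g (x i) k != 0.
Proof.
move=> cd gP xinj fxy ci0; have [d0 _ _ _] := cd.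
have [i _ imax] := @arg_maxP _ _ _ i0 xpredT (fun i => `|c i|) isT.
have ci : 0 < `|c i| by apply: lt_le_trans (imax i0 isT); rewrite normr_gt0.
have sepj j : exists n : nat, j != i -> n.+1%:R^-1 <= dist (x i) (x j).
  have [->|ji] := eqVneq j i; first by exists 0%N.
  have dij : 0 < dist (x i) (x j).
    rewrite lt_neqAle (compatible_metric_ge0 _ _ cd) andbT eq_sym.
    by apply: contra ji => /eqP/(d0 _ _)/xinj ->.
  exists (Num.trunc (dist (x i) (x j))^-1) => _.
  by rewrite invf_ple ?posrE ?ltr0Sn// ltW// truncnS_gt.
have /choice[s sP] := sepj.
pose n := maxn (maxn M m) (\max_j s j).
have sepn j : j != i -> n.+1%:R^-1 <= dist (x i) (x j).
  move=> /sP; apply: le_trans; rewrite lef_pV2 ?posrE ?ltr0Sn// ler_nat ltnS.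
  by rewrite leq_max (leq_bigmax j) orbT.
have [beta [_ beta0 /(_ (x i))[k [nk gk gfar]]]] := gP n.
exists k; first by apply: leq_trans nk; rewrite !leq_max leqnn.
have G0 : 0 < `|g (x i) k| by apply: lt_le_trans gk.
have small j : j != i -> n.+1%:R * `|g (x j) k| <= `|g (x i) k|.
  move=> ji; have := gfar (x j); rewrite !fxy => /(_ erefl (sepn j ji)).
  by have := beta0 y; lra.
apply/eqP; rewrite (bigD1 i)//= => /eqP; rewrite addr_eq0 => /eqP cg.
have : `|c i| * `|g (x i) k| <= `|c i| * \sum_(j | j != i) `|g (x j) k|.
  rewrite -normrM cg normrN mulr_sumr; apply: le_trans (ler_norm_sum _ _ _) _.
  by apply: ler_sum => j _; rewrite normrM ler_wpM2r//; exact: imax.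
rewrite ler_pM2l// => /(ler_wpM2l (ler0n R n.+1)).
apply/negP; rewrite -ltNge mulr_sumr.
apply: le_lt_trans (_ : \sum_(j | j != i) `|g (x i) k| < _).
  by apply: ler_sum => j; exact: small.
rewrite sumr_const -[ltLHS]mulr_natl ltr_pM2r// ltr_nat ltnS.
apply: leq_trans (max_card _) _; rewrite card_ord.
by rewrite !leq_max leqnn orbT.
Qed.

End Isolating.

(** * Approximation by isolating maps *)

Section Approximation.
Context {R : realType}.

(** The index beyond which the tails are small is found over a neighbourhood of
    each point; [cut] is the reciprocal of a continuous modulus and bounds
    these indices continuously on [Y]. *)
Lemma small_tails_over_fibers (X Y : topologicalType) (f : X -> Y)
    (distY : Y -> Y -> R) (g : X -> l2 R) (eps : Y -> R) :
  perfect_map f -> compatible_metric distY -> continuous g ->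
  continuous eps -> (forall y, 0 < eps y) ->
  exists cut : Y -> R, [/\ continuous cut, forall y, 0 < cut y
    & forall x N n, cut (f x) <= N%:R ->
        \sum_(N <= k < n) g x k ^+ 2 <= eps (f x) ^+ 2].
Proof.
move=> pf cdY cg ceps eps0; have cf : continuous f by case: pf.
pose P x (e : R) := 0 < e -> forall N n, e^-1 <= N%:R ->
  \sum_(N <= k < n) g x k ^+ 2 <= eps (f x) ^+ 2.
have Pdown x a b : a <= b -> P x b -> P x a.
  move=> ab Pb a0 N n aN; apply: (Pb (lt_le_trans a0 ab)).
  by apply: le_trans aN; rewrite lef_pV2 ?posrE// (lt_le_trans a0).
have Ploc (x : X) : exists2 e, 0 < e & \forall x' \near x, P x' e.
  have e2 : 0 < eps (f x) / 2 by rewrite divr_gt0.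
  have [N tailN] := l2_tail_near (cg x) e2.
  exists N.+1%:R^-1; first by rewrite invr_gt0 ltr0Sn.
  have : eps (f z) @[z --> x] --> eps (f x).
    by apply: (@continuous_comp _ _ _ f eps); [exact: cf|exact: ceps].
  move=> /cvgrPdist_lt/(_ _ e2); apply: filterS2 tailN => x' tailN xx' _ N' n.
  rewrite invrK ler_nat => NN'.
  have [N'n|nN'] := leqP N' n; last by rewrite (big_geq (ltnW nN')) sqr_ge0.
  apply: le_trans (_ : \sum_(N <= k < n) g x' k ^+ 2 <= _).
    rewrite [leRHS](big_cat_nat (n := N'))//= ?(ltnW NN')// lerDr.
    by apply: sumr_ge0 => k _; exact: sqr_ge0.
  apply: le_trans (tailN n) _.
  rewrite ler_sqr ?nnegrE ?ltW//.
  by move: xx'; rewrite ltr_norml; lra.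
have [eta [ceta eta01 etaP]] := modulus_over_fibers pf cdY Pdown Ploc.
have eta0 y : 0 < eta y by have /andP[] := eta01 y.
exists (fun y => (eta y)^-1); split.
- by move=> y; apply: cvgV; [rewrite gt_eqF|exact: ceta].
- by move=> y; rewrite invr_gt0.
- by move=> x N n; exact: etaP.
Qed.

(** The approximation has the coordinates
    [theta k (f x) * g0 x k + eps (f x) / 2 * 2^-1 ^+ k.+1 * phi k x].  The
    cut-off [theta k] equals 1 up to the index [cut], so that only a small tail
    of [g0] is lost, and 0 from [cut + 1] on, so that late coordinates are pure
    bumps. *)
Lemma isolating_approximation (X Y : topologicalType) (f : X -> Y)
    (distX : X -> X -> R) (distY : Y -> Y -> R)
    (g0 : bounded_continuous_map R X) (alpha : X -> R) :
  perfect_map f -> C_space Y ->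
  compatible_metric distX -> compatible_metric distY ->
  continuous alpha -> (forall x, 0 < alpha x) ->
  exists g : bounded_continuous_map R X,
    (forall x, `|g0 x - g x| <= alpha x) /\
    forall n, isolating f distX n g.
Proof.
move=> pf CY cdX cdY calpha alpha0; have cf : continuous f by case: pf.
have [eps [ceps eps01 eps_alpha]] : exists eps : Y -> R,
    [/\ continuous eps, forall y, 0 < eps y <= 1
      & forall x, eps (f x) <= alpha x].
  apply: (modulus_over_fibers (P := fun x e => e <= alpha x) pf cdY).
    by move=> x a b; exact: le_trans.
  move=> x; have a2 : 0 < alpha x / 2 by rewrite divr_gt0.
  exists (alpha x / 2) => //.
  have /cvgrPdist_lt/(_ _ a2) := calpha x; apply: filterS => x'.
  by rewrite ltr_norml; lra.
have eps0 y : 0 < eps y by have /andP[] := eps01 y.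
have eps1 y : eps y <= 1 by have /andP[] := eps01 y.
have [cut [ccut cut0 cutP]] : exists cut : Y -> R,
    [/\ continuous cut, forall y, 0 < cut y
      & forall x N n, cut (f x) <= N%:R ->
        \sum_(N <= k < n) g0 x k ^+ 2 <= (eps (f x) / 2) ^+ 2].
  apply: (small_tails_over_fibers (eps := fun y => eps y / 2) pf cdY).
  - exact: bcm_continuous.
  - by move=> y; apply: cvgM; [exact: ceps|exact: cvg_cst].
  - by move=> y; rewrite divr_gt0.
have [phi [cphi phi01 phiP]] := fiberwise_bump_sequence pf CY cdX cdY.
pose theta k y : R := Num.min 1 (Num.max 0 (cut y + 1 - k%:R)).
have theta01 k y : 0 <= theta k y <= 1.
  by rewrite /theta le_min ler01 le_max lexx ge_min lexx.
have theta1 k y : k%:R <= cut y -> theta k y = 1.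
  move=> ky; apply/min_idPl; rewrite le_max; apply/orP; right; lra.
have theta0 k y : cut y + 1 <= k%:R -> theta k y = 0.
  move=> ky; rewrite /theta (max_idPl _); last lra.
  by apply/min_idPr.
have ctheta k : continuous (theta k).
  move=> y; apply: (@continuous_min _ _ (cst 1)
    (cst 0 \max (fun y => cut y + 1 - k%:R))); first exact: cvg_cst.
  apply: continuous_max; first exact: cvg_cst.
  apply: cvgB; last exact: cvg_cst.
  by apply: cvgD; [exact: ccut|exact: cvg_cst].
pose b x k : R := eps (f x) / 2 * 2^-1 ^+ k.+1 * phi k x.
have half0 k : 0 < 2^-1 ^+ k :> R by rewrite exprn_gt0// invr_gt0.
have half1 k : 2^-1 ^+ k <= 1 :> R.
  by rewrite exprn_ile1 ?invr_ge0// invf_le1// ler1n.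
(* Squaring keeps one factor 2^-1 ^+ k.+1, so the squares sum to at most the
   square of eps / 2. *)
have bsqr x k : b x k ^+ 2 <= (eps (f x) / 2) ^+ 2 * 2^-1 ^+ k.+1.
  have /andP[p0 p1] := phi01 k x.
  rewrite /b -mulrA exprMn ler_wpM2l ?sqr_ge0//.
  rewrite exprMn -[leRHS]mulr1 ler_pM ?sqr_ge0//.
    by rewrite expr2 ler_piMr ?(ltW (half0 _)) ?half1.
  by rewrite exprn_ile1.
have bsum x N n : \sum_(N <= k < n) b x k ^+ 2 <=
    (eps (f x) / 2) ^+ 2 * 2^-1 ^+ N.
  apply: le_trans (_ : (eps (f x) / 2) ^+ 2 *
    \sum_(N <= k < n) 2^-1 ^+ k.+1 <= _).
    by rewrite mulr_sumr; apply: ler_sum => k _.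
  by rewrite ler_wpM2l ?sqr_ge0// sum_half_pow_le.
have b0 x n : \sum_(k < n) b x k ^+ 2 <= (eps (f x) / 2) ^+ 2.
  have := bsum x 0%N n; rewrite expr0 mulr1.
  by rewrite (big_mkord xpredT (fun k => b x k ^+ 2)).
have tsum x n : \sum_(k < n) (theta k (f x) * g0 x k) ^+ 2 <= `|g0 x| ^+ 2.
  apply: le_trans (l2_partial_sum_le (g0 x) n); apply: ler_sum => k _.
  have /andP[t0 t1] := theta01 k (f x).
  by rewrite exprMn ler_piMl ?sqr_ge0// exprn_ile1.
(* The summands with index below cut vanish and the others form a tail of g0. *)
have rsum x n : \sum_(k < n) ((1 - theta k (f x)) * g0 x k) ^+ 2 <=
    (eps (f x) / 2) ^+ 2.
  pose N := (Num.trunc (cut (f x))).+1.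
  have cutN : cut (f x) <= N%:R by rewrite ltW// truncnS_gt.
  have ltN k : (k < N)%N -> theta k (f x) = 1.
    rewrite ltnS => kN; apply: theta1.
    apply: le_trans (_ : (Num.trunc (cut (f x)))%:R <= _); first by rewrite ler_nat.
    by rewrite truncn_le// ltW.
  rewrite -(big_mkord xpredT (fun k => ((1 - theta k (f x)) * g0 x k) ^+ 2)).
  have small i j : \sum_(i <= k < j) ((1 - theta k (f x)) * g0 x k) ^+ 2 <=
      \sum_(i <= k < j) g0 x k ^+ 2.
    apply: ler_sum => k _; have := theta01 k (f x) => /andP[t0 t1].
    rewrite exprMn ler_piMl ?sqr_ge0// exprn_ile1//; lra.
  have zero j : (j <= N)%N ->
      \sum_(0 <= k < j) ((1 - theta k (f x)) * g0 x k) ^+ 2 = 0.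
    move=> jN; rewrite big_nat big1// => k /andP[_ kj].
    by rewrite ltN ?(leq_trans kj)// subrr mul0r expr0n.
  have [nN|Nn] := leqP n N; first by rewrite zero// sqr_ge0.
  rewrite (big_cat_nat (n := N)) ?(ltnW Nn)//= zero// add0r.
  exact: le_trans (small _ _) (cutP x N n cutN).
have /choice[u uE] : forall x, exists u : l2 R,
    forall k, u k = theta k (f x) * g0 x k + b x k.
  move=> x.
  have [u uE] := l2_of_square_summable
    (w := fun k => theta k (f x) * g0 x k + b x k)
    (fun n => sum_sqrD_le2 (tsum x n) (b0 x n)).
  by exists u.
have g0u x : `|g0 x - u x| <= eps (f x).
  apply/l2_norm_leP; first exact: ltW.
  move=> n; under eq_bigr => k _.
    have -> : (g0 x - u x) k = (1 - theta k (f x)) * g0 x k + - b x k.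
      rewrite -[LHS]/(g0 x k - u x k) uE; ring.
    over.
  have nb : \sum_(k < n) (- b x k) ^+ 2 <= (eps (f x) / 2) ^+ 2.
    by under eq_bigr do rewrite sqrrN.
  apply: le_trans (sum_sqrD_le2 (rsum x n) nb) _; lra.
have cut_near (y : Y) : exists M : nat, \forall y' \near y, cut y' + 1 <= M%:R.
  exists (Num.trunc (cut y + 2)).+1.
  have /cvgrPdist_lt/(_ 1 ltr01) := ccut y; apply: filterS => y'.
  have := truncnS_gt (cut y + 2); rewrite ltr_norml; lra.
(* Near x the coordinates of large index come from the bumps alone, whose tails
   are geometrically small. *)
have cu : continuous u.
  apply: continuous_l2 => [k x|x e e0].
    have -> : (fun x => u x k : R) = (fun x => theta k (f x) * g0 x k + b x k).
      by apply/funext => z; exact: uE.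
    apply: cvgD; apply: cvgM.
    - by apply: (@continuous_comp _ _ _ f (theta k)); [exact: cf|exact: ctheta].
    - exact: continuous_l2_coord (@bcm_continuous _ _ g0) x.
    - apply: cvgM; last exact: cvg_cst.
      apply: cvgM; last exact: cvg_cst.
      by apply: (@continuous_comp _ _ _ f eps); [exact: cf|exact: ceps].
    - exact: cphi k x.
  have [M cutM] := cut_near (f x).
  have [N Ne] : exists N : nat, 2^-1 ^+ N < e ^+ 2.
    have e20 : 0 < e ^+ 2 by rewrite exprn_gt0.
    have [N _ /(_ N (leqnn N))] := near_infty_natSinv_expn_lt (PosNum e20).
    by rewrite /= div1r -exprVn; exists N.
  exists (maxn M N).
  have : \forall x' \near x, cut (f x') + 1 <= M%:R by exact: cf cutM.
  apply: filterS => x' cutx' n.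
  rewrite (eq_big_nat _ _ (F2 := fun k => b x' k ^+ 2)) => [|k]; last first.
    rewrite geq_max => /andP[/andP[Mk _] _].
    rewrite uE theta0 ?mul0r ?add0r//; apply: le_trans cutx' _.
    by rewrite ler_nat.
  apply: le_trans (bsum _ _ _) _; apply: le_trans (ltW Ne).
  apply: le_trans (_ : 2^-1 ^+ maxn M N <= _).
    rewrite ler_piMl ?(ltW (half0 _))// exprn_ile1//.
    - by rewrite divr_ge0// ltW.
    - by have := eps1 (f x'); lra.
  by rewrite ler_wiXn2l ?leq_maxr// ?invr_ge0// invf_le1// ler1n.
have bu : bounded_fun u.
  have [K [_ g0K]] := bcm_bounded g0.
  exists (K + 1); split=> [|M KM x _ /=]; first exact: num_real.
  have : K < M - 1 by rewrite ltrBrDr.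
  move=> /g0K/(_ x I) /=; have := g0u x; have := eps1 (f x).
  have := ler_normD (u x - g0 x) (g0 x); rewrite subrK distrC; lra.
exists (Build_bounded_continuous_map cu bu); split.
  by move=> x /=; apply: le_trans (g0u x) (eps_alpha x).
(* The margin is found locally over Y: near y all coordinates of index at least
   M are pure bumps, and those with index at most N have a coefficient bounded
   below. *)
move=> n; pose P y (e : R) := forall x, f x = y ->
  exists k, [/\ (n <= k)%N, e <= `|u x k|
    & forall x', f x' = f x -> n.+1%:R^-1 <= distX x x' -> u x' k = 0].
have Pdown y a c : a <= c -> P y c -> P y a.
  move=> ac Pc x /Pc[k [nk ck farx]].
  by exists k; split=> //; exact: le_trans ck.
have [beta [cbeta beta01 betaP beta_pos]] := continuous_pointwise_modulus cdY Pdown.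
have beta0 y : 0 < beta y.
  apply: beta_pos; have [M cutM] := cut_near y.
  have [N [delta delta0 bump]] := phiP y n.+1%:R^-1 (maxn n M) ltac:(by rewrite invr_gt0 ltr0Sn).
  have e2 : 0 < eps y / 2 by rewrite divr_gt0.
  exists (eps y / 2 / 2 * 2^-1 ^+ N.+1 * delta).
    by rewrite !mulr_gt0 ?invr_gt0.
  have /cvgrPdist_lt/(_ _ e2) := ceps y.
  apply: filterS3 cutM bump => y' cutM bump epsy x fxy'.
  have [k [/andP[]]] := bump x fxy'; rewrite geq_max => /andP[nk Mk] kN dk farx.
  have uk z : f z = y' -> u z k = b z k.
    move=> fz; rewrite uE theta0 ?mul0r ?add0r// fz; apply: le_trans cutM _.
    by rewrite ler_nat.
  exists k; split=> //.
    apply: le_trans (ler_norm _); rewrite uk// /b fxy'.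
    rewrite ler_pM//; first by rewrite !mulr_ge0// ?invr_ge0 ?(ltW (half0 _))// ltW.
    - by rewrite ltW.
    rewrite ler_pM ?(ltW (half0 _))//; first by rewrite ltW// divr_gt0.
      by move: epsy; rewrite ltr_norml; lra.
    by rewrite ler_wiXn2l ?invr_ge0// invf_le1// ler1n.
  move=> x' fx' far; rewrite uk ?fx'// /b; have [->|/(farx x' fx')] := eqVneq (phi k x') 0.
    by rewrite mulr0.
  by rewrite ltNge far.
exists beta; split=> // x; have [k [nk bk farx]] := betaP (f x) (beta0 _) x erefl.
by exists k; split=> // x' fx' far; rewrite (farx x' fx' far) normr0 mulr0 add0r.
Qed.

End Approximation.

(** * Points of planes parallel to coordinate planes *)

Section Planes.
Context {R : realType}.

Lemma row_dependency (a b : nat) (M : 'M[R]_(a, b)) : (b < a)%N ->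
  exists2 c : 'rV[R]_a, c != 0 & c *m M = 0.
Proof.
move=> ba; have : kermx M != 0.
  by rewrite -mxrank_eq0 mxrank_ker subn_eq0 -ltnNge (leq_ltn_trans (rank_leq_col M)).
by move=> /rowV0Pn[c /sub_kermxP cM c0]; exists c.
Qed.

Lemma card_le_II_noninjective (T : Type) (A : set T) (n : nat) :
  (forall x : 'I_n.+1 -> T, (forall i, A (x i)) -> ~ injective x) -> A #<= `I_n.
Proof.
move=> noinj; apply: contrapT => nA.
have : `I_n.+1 #<= A.
  have [/finite_setP[N AN]|/infiniteP] := pselect (finite_set A).
    move: nA; rewrite (card_le_eql AN) (card_le_eqr AN) !card_le_II.
    by move/negP; rewrite -ltnNge.
  by apply: card_le_trans; exact: card_leT.
elim/Ppointed: T A noinj {nA} => T A noinj; first by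
  rewrite !emptyE => /seteqP[/(_ 0%N (ltn0Sn n))].
move=> /pcard_leP[h].
apply: (noinj (fun i => h (val i))) => [i|i j hij]; first by apply: funS => /=.
by apply/val_inj/(@inj _ _ _ h) => //; rewrite inE /=.
Qed.

Lemma l2_sum_coord (m : nat) (c : 'I_m -> R) (w : 'I_m -> l2 R) k :
  (\sum_i c i *: w i : l2 R) k = \sum_i c i * w i k.
Proof.
by rewrite (big_morph (fun u : l2 R => u k : R) (id1 := 0) (op1 := +%R)).
Qed.

Lemma coordinate_plane_vanish r (k : 'I_r -> nat) (w : l2 R) :
  lin_span (l2_basis \o k) w ->
  forall j, (\max_i k i < j)%N -> w j = 0.
Proof.
move=> [c _ <-] j kj.
rewrite l2_sum_coord big1// => i _; rewrite -[X in _ * X]/((j == k i)%:R).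
by rewrite gtn_eqF ?mulr0// (leq_ltn_trans _ kj)// (leq_bigmax i).
Qed.

Lemma lin_span_basis_indep r (k : 'I_r -> nat) : injective k ->
  lin_indep (l2_basis \o k : 'I_r -> l2 R).
Proof.
move=> kinj c c0 i; have : (0 : l2 R) (k i) = 0 by [].
rewrite -c0 l2_sum_coord (bigD1 i)//= big1 ?addr0 => [|j ji].
  by rewrite -[X in _ * X]/((k i == k i)%:R) eqxx mulr1.
rewrite -[X in _ * X]/((k i == k j)%:R).
by rewrite (inj_eq kinj) eq_sym (negbTE ji) mulr0.
Qed.

(** Write the [d + 2 - r] points and the [r] basis vectors in terms of the
    spanning vectors of the direction, adding a coordinate 1 for the points and
    0 for the basis vectors.  These are [d + 2] rows of length [d + 1], hence
    dependent; the extra coordinate makes the base point of the plane cancel, and the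
    independence of the basis vectors prevents all the points from having
    coefficient zero. *)
Lemma points_of_parallel_plane (d r : nat) (P : set (l2 R)) (w : 'I_(d.+1 - r).+1 -> l2 R) :
  parallel_planes d r P -> (r <= d)%N -> (forall i, P (w i)) ->
  exists (c : 'I_(d.+1 - r).+1 -> R) (i0 : 'I_(d.+1 - r).+1) (J : nat),
    c i0 != 0 /\ forall j, (J <= j)%N -> \sum_i c i * w i j = 0.
Proof.
move=> [V [W [[p [v [_ VE PE]]] [k kinj WE] WV _]]] rd; move: (WV rd) => {}WV.
move: w; set m := (d.+1 - r).+1 => w Pw.
have /choice[a aP] : forall i, exists a : 'I_d -> R, w i = p + \sum_j a j *: v j.
  move=> i; have := Pw i; rewrite PE VE => -[_ [a _ <-] <-].
  by exists a.
have /choice[b bP] : forall l : 'I_r, exists b : 'I_d -> R,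
    l2_basis (k l) = \sum_j b j *: v j.
  move=> l; have : V (l2_basis (k l)).
    apply: WV; rewrite WE; exists (fun i => (i == l)%:R) => //.
    rewrite (bigD1 l)//= eqxx scale1r big1 ?addr0// => i il.
    by rewrite (negbTE il) scale0r.
  by rewrite VE => -[b _ <-]; exists b.

(* Column 0 is the extra coordinate, the other columns are those of a and b. *)
pose M : 'M[R]_(m + r, d.+1) := col_mx
  (\matrix_(i, j) if unlift ord0 j is Some j' then a i j' else 1)
  (\matrix_(l, j) if unlift ord0 j is Some j' then b l j' else 0).
have [|c c0 cM] := row_dependency M.
  by rewrite /m addSn ltnS subnK// leqW.
pose c1 i := c 0 (lshift r i); pose c2 l := c 0 (rshift m l).
have colM j : \sum_i c1 i * M (lshift r i) j + \sum_l c2 l * M (rshift m l) j = 0.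
  by have /matrixP/(_ 0 j) := cM; rewrite !mxE big_split_ord.
have sum_c1 : \sum_i c1 i = 0.
  rewrite -[RHS](colM ord0) [X in _ = _ + X]big1 ?addr0 => [|l _].
    by apply: eq_bigr => i _; rewrite col_mxEu mxE unlift_none mulr1.
  by rewrite col_mxEd mxE unlift_none mulr0.
have coef j : \sum_i c1 i * a i j + \sum_l c2 l * b l j = 0.
  rewrite -[RHS](colM (lift ord0 j)); congr (_ + _); apply: eq_bigr => i _.
    by rewrite col_mxEu mxE liftK.
  by rewrite col_mxEd mxE liftK.
have dep : \sum_i c1 i *: w i + \sum_l c2 l *: l2_basis (k l) = 0.
  have -> : \sum_i c1 i *: w i = \sum_j (\sum_i c1 i * a i j) *: v j.
    under eq_bigr => i _ do rewrite aP scalerDr scaler_sumr.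
    rewrite big_split /= -scaler_suml sum_c1 scale0r add0r exchange_big /=.
    by apply: eq_bigr => j _; rewrite scaler_suml; apply: eq_bigr => i _; rewrite scalerA.
  have -> : \sum_l c2 l *: l2_basis (k l) = \sum_j (\sum_l c2 l * b l j) *: v j.
    under eq_bigr => i _ do rewrite bP scaler_sumr.
    rewrite exchange_big /=.
    by apply: eq_bigr => j _; rewrite scaler_suml; apply: eq_bigr => i _; rewrite scalerA.
  by rewrite -big_split big1//= => j _; rewrite -scalerDl coef scale0r.
have [i0 ci0] : exists i0, c1 i0 != 0.
  apply: contrapT => /forallNP c10.
  have c1E i : c1 i = 0 by apply/eqP/negPn/negP; exact: c10.
  move: dep; rewrite big1 ?add0r => [|i _]; last by rewrite c1E scale0r.
  move=> /(lin_span_basis_indep kinj) c2E.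
  case/eqP: c0; apply/matrixP => i j; rewrite ord1 mxE.
  by case: (split_ordP j) => l ->; [exact: c1E|exact: c2E].
exists c1, i0, (\max_i k i).+1; split=> // j kj.
rewrite -l2_sum_coord; move/eqP: dep; rewrite addr_eq0 => /eqP ->.
apply: (@coordinate_plane_vanish r k) kj.
by exists (fun l => - c2 l) => //; rewrite -sumrN; apply: eq_bigr => l _; rewrite scaleNr.
Qed.

Lemma difference_in_parallel_plane (d r : nat) (P : set (l2 R)) (w w' : l2 R) :
  parallel_planes d r P -> (d <= r)%N -> P w -> P w' ->
  exists J : nat, forall j, (J <= j)%N -> w j = w' j.
Proof.
move=> [V [W [[p [v [_ VE ->]]] [k _ WE] _ VW]]] /VW{}VW [u Vu <-] [u' Vu' <-].
exists (\max_i k i).+1 => j kj; rewrite -[LHS]/(p j + u j) -[RHS]/(p j + u' j).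
by congr (_ + _); rewrite !(@coordinate_plane_vanish r k)// -WE; exact: VW.
Qed.

End Planes.

(** * The theorem *)

Theorem theorem1p7 (R : realType) (X Y : topologicalType) (f : X -> Y)
    (metrizableX : metrizable R X) (metrizableY : metrizable R Y)
    (CY : C_space Y) (perfect_f : perfect_map f) :
  exists G : set (bounded_continuous_map R X),
    [/\ Gdelta G, dense G
      & forall g, G g ->
        forall (d r : nat) (y : Y) (P : set (l2 R)), parallel_planes d r P ->
          ((r <= d)%N -> f @^-1` [set y] `&` g @^-1` P #<= `I_(d.+1 - r)) /\
          ((d <= r)%N -> f @^-1` [set y] `&` g @^-1` P #<= `I_1)].
Proof.
have [distX cdX] := metrizableX; have [distY cdY] := metrizableY.
have cf : continuous f by case: perfect_f.
exists (\bigcap_n [set g : bounded_continuous_map R X | isolating f distX n g]).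
split.
- by exists (fun n => [set g : bounded_continuous_map R X |
    isolating f distX n g]) => // n; exact: open_isolating.
- move=> U [g0 Ug0]; rewrite openE_source_limitation.
  move=> /(_ g0 Ug0)[alpha [calpha alpha0 alphaU]].
  have [g [g0g gP]] :=
    isolating_approximation g0 perfect_f CY cdX cdY calpha alpha0.
  by exists g; split=> [|n _]; [exact: alphaU|exact: gP].
move=> g Gg d r y P PP.
have gP n : isolating f distX n g by exact: Gg.
split=> [rd|dr]; apply: card_le_II_noninjective => x xA xinj.
- have [i|c [i0 [J [ci0 cJ]]]] :=
    points_of_parallel_plane (w := fun i => g (x i)) PP rd; first by case: (xA i).
  have [k Jk] := isolating_independent J cdX gP xinj (fun i => proj1 (xA i)) ci0.
  by rewrite cJ// eqxx.
- have [J wJ] := difference_in_parallel_plane PP dr (proj2 (xA ord0)) (proj2 (xA ord_max)).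
  pose c (i : 'I_2) : R := if i == ord0 then 1 else -1.
  have c0 : c ord0 != 0 by exact: oner_neq0.
  have [k Jk] := isolating_independent J cdX gP xinj (fun i => proj1 (xA i)) c0.
  rewrite big_ord_recr big_ord1 /= /c.
  have -> : widen_ord (leqnSn 1) ord0 = ord0 by exact: val_inj.
  by rewrite eqxx mul1r mulN1r wJ// subrr eqxx.
Qed.
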